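(* Let $(Q,c)\in\mathcal{S}^n\times\mathbb{R}^n$, let $\hat x\in F$ and let $\mathbb{B}=\{j\in\{1,\dots,n\}:0<\hat x_j<1\}$. (i) $\ell_R(\hat x)=q(\hat x)$ if and only if $\hat x$ is a vertex of $F$ or $Q_{\mathbb{B}\mathbb{B}}=0$. (ii) $\ell_{RS}(\hat x)=q(\hat x)$ if and only if $\hat x$ is a vertex of $F$ or $Q_{\mathbb{B}\mathbb{B}}\succeq0$.
   Context: Let $n \ge 1$, let $\mathcal{S}^n$ be the space of real symmetric $n\times n$ matrices, $e \in \mathbb{R}^n$ the all-ones vector, $\langle A,B\rangle = \mathrm{trace}(A^TB)$; $A\succeq0$ means positive semidefinite, and $Q_{\mathbb{B}\mathbb{B}}$ is the principal submatrix of $Q$ indexed by $\mathbb{B}$. Let $q(x)=\frac12x^TQx+c^Tx$, $F = \{x \in \mathbb{R}^n : 0 \le x \le e\}$ (vertices: $\{0,1\}^n$), $$\mathcal{F}_R = \{(x,X)\in\mathbb{R}^n\times\mathcal{S}^n : 0\le x\le e,\ \max\{x_i+x_j-1,0\}\le X_{ij}\le \min\{x_i,x_j\},\ 1\le i\le j\le n\},$$ and $\mathcal{F}_{RS}=\{(x,X)\in\mathcal{F}_R:X-xx^T\succeq0\}$. For $\hat x\in F$, $\ell_R(\hat x)=\min\{\frac12\langle Q,X\rangle+c^T\hat x : X\in\mathcal{S}^n,\ (\hat x,X)\in\mathcal{F}_R\}$ and $\ell_{RS}(\hat x)=\min\{\frac12\langle Q,X\rangle+c^T\hat x : X\in\mathcal{S}^n,\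 (\hat x,X)\in\mathcal{F}_{RS}\}$. *)

(* Defs.v *)
From HB Require Import structures.
From mathcomp Require Import all_boot all_order all_algebra.
From mathcomp Require Import all_classical all_reals all_analysis.
From mathcomp Require Import ring lra.

Set Implicit Arguments.
Unset Strict Implicit.
Unset Printing Implicit Defensive.

Import Order.TTheory GRing.Theory Num.Theory.
Import numFieldNormedType.Exports.

Local Open Scope classical_set_scope.
Local Open Scope ring_scope.

Definition mxinner (R : realType) (n : nat) (A B : 'M[R]_n) : R :=
  \tr (A^T *m B).

Definition cvinner (R : realType) (n : nat) (u v : 'cV[R]_n) : R :=
  (u^T *m v) ord0 ord0.

Definition psd (R : realType) (n : nat) (A : 'M[R]_n) : Prop :=
  A \is symmetricmx /\ forall u : 'cV[R]_n, 0 <= cvinner u (A *m u).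

Definition quad (R : realType) (n : nat) (Q : 'M[R]_n) (c x : 'cV[R]_n) : R :=
  2^-1 * cvinner x (Q *m x) + cvinner c x.

Definition box (R : realType) (n : nat) : set 'cV[R]_n :=
  [set x | forall i, 0 <= x i ord0 <= 1].

(* Vertices are extreme points; [vertex_boxP] below identifies those of the
   unit box with the 0/1 vectors. *)
Definition vertex (R : realType) (n : nat) (P : set 'cV[R]_n) (x : 'cV[R]_n) :
    Prop :=
  P x /\ forall (y z : 'cV[R]_n) (t : R), P y -> P z -> 0 < t < 1 ->
    x = t *: y + (1 - t) *: z -> y = z.

Definition setFR (R : realType) (n : nat) : set ('cV[R]_n * 'M[R]_n) :=
  [set p | [/\ box p.1, p.2 \is symmetricmx &
    forall i j : 'I_n, (i <= j)%N ->
      Num.max (p.1 i ord0 + p.1 j ord0 - 1) 0 <= p.2 i j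
        <= Num.min (p.1 i ord0) (p.1 j ord0)]].

Definition setFRS (R : realType) (n : nat) : set ('cV[R]_n * 'M[R]_n) :=
  [set p | setFR p /\ psd (p.2 - p.1 *m p.1^T)].

Definition lifted_obj (R : realType) (n : nat) (Q : 'M[R]_n) (c x : 'cV[R]_n)
    (X : 'M[R]_n) : R :=
  2^-1 * mxinner Q X + cvinner c x.

Definition lifted_values (R : realType) (n : nat)
    (K : set ('cV[R]_n * 'M[R]_n)) (Q : 'M[R]_n) (c x : 'cV[R]_n) : set R :=
  [set lifted_obj Q c x X | X in [set X : 'M[R]_n | K (x, X)]].

(* The minima over X are written with [inf]; [ellR_min] and [ellRS_min] below
   show that they are attained at every x in the box. *)
Definition ellR (R : realType) (n : nat) (Q : 'M[R]_n) (c x : 'cV[R]_n) : R :=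
  inf (lifted_values (@setFR R n) Q c x).

Definition ellRS (R : realType) (n : nat) (Q : 'M[R]_n) (c x : 'cV[R]_n) : R :=
  inf (lifted_values (@setFRS R n) Q c x).

Definition fracset (R : realType) (n : nat) (x : 'cV[R]_n) : {set 'I_n} :=
  [set j : 'I_n | 0 < x j ord0 < 1]%SET.

(* The rows and columns indexed by B are kept in the enumeration order of B;
   when B is empty this is the 0 x 0 matrix. *)
Definition principal_submx (R : realType) (n : nat) (Q : 'M[R]_n)
    (B : {set 'I_n}) : 'M[R]_#|B| :=
  mxsub enum_val enum_val Q.

Lemma vertex_boxP (R : realType) (n : nat) (x : 'cV[R]_n) :
  vertex (@box R n) x <-> forall i, x i ord0 = 0 \/ x i ord0 = 1.
Proof.
split=> [[bx ext] i|x01].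
- have /andP[x0 x1] := bx i.
  have [/eqP|xi0] := boolP (x i ord0 == 0); first by left.
  have [/eqP|xi1] := boolP (x i ord0 == 1); first by right.
  exfalso.
  have {}x0 : 0 < x i ord0 by rewrite lt_neqAle eq_sym xi0.
  have {}x1 : x i ord0 < 1 by rewrite lt_neqAle xi1.
  pose y (a : R) : 'cV[R]_n :=
    \col_j (if j == i then a else x j ord0).
  have by_ a : 0 <= a <= 1 -> box (y a).
    by move=> a01 j; rewrite mxE; case: ifP.
  have := ext (y 1) (y 0) (x i ord0) (by_ _ _) (by_ _ _) _ _.
  rewrite !lexx !ler01 x0 x1 => /(_ isT isT isT) H.
  have /colP/(_ i) : y 1 = y 0.
    apply: H; apply/colP => j; rewrite !mxE; case: eqP => [->|_]; ring.
  by rewrite !mxE eqxx => /eqP; rewrite oner_eq0.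
- split=> [i|y z t by_ bz /andP[t0 t1] xE].
    by case: (x01 i) => ->; rewrite ?lexx ?ler01.
  apply/colP => i; have /colP/(_ i) := xE; rewrite !mxE.
  have /andP[y0 y1] := by_ i; have /andP[z0 z1] := bz i.
  by case: (x01 i) => ->; nra.
Qed.

Lemma symmetricmxP (R : realType) (n : nat) (A : 'M[R]_n) :
  reflect (A^T = A) (A \is symmetricmx).
Proof.
apply: (iffP (is_hermitianmxP _ _ _)); rewrite expr0 scale1r => E.
  by rewrite {2}E; apply/matrixP => i j; rewrite !mxE.
by rewrite -{1}E; apply/matrixP => i j; rewrite !mxE.
Qed.

Lemma mxinnerE (R : realType) (n : nat) (A B : 'M[R]_n) :
  mxinner A B = \sum_i \sum_j A i j * B i j.
Proof.
rewrite /mxinner /mxtrace exchange_big /=; apply: eq_bigr => j _.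
by rewrite mxE; apply: eq_bigr => i _; rewrite mxE.
Qed.

Lemma cvinner_mulmxE (R : realType) (n : nat) (A : 'M[R]_n) (u : 'cV[R]_n) :
  cvinner u (A *m u) = \sum_i \sum_j u i ord0 * A i j * u j ord0.
Proof.
rewrite /cvinner mxE; apply: eq_bigr => i _; rewrite !mxE mulr_sumr.
by apply: eq_bigr => j _; rewrite mulrA.
Qed.

Lemma setFRS_rank1 (R : realType) (n : nat) (x : 'cV[R]_n) :
  box x -> setFRS (x, x *m x^T).
Proof.
move=> bx; have xxE i j : (x *m x^T) i j = x i ord0 * x j ord0.
  by rewrite mxE big_ord1 mxE.
split; last first.
  rewrite /= subrr; split; first by apply/symmetricmxP; rewrite linear0.
  by move=> u; rewrite /cvinner mul0mx mulmx0 mxE.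
split=> //=; first by apply/symmetricmxP; rewrite trmx_mul trmxK.
move=> i j _; rewrite xxE ge_max le_min.
have /andP[xi0 xi1] := bx i; have /andP[xj0 xj1] := bx j.
by apply/andP; split; apply/andP; split; nra.
Qed.

Lemma psd_rank1_subE (R : realType) (n : nat) (x : 'cV[R]_n) (X : 'M[R]_n) :
  X \is symmetricmx ->
  psd (X - x *m x^T) <->
  forall u : 'cV[R]_n, 0 <= cvinner u ((X - x *m x^T) *m u).
Proof.
move=> /symmetricmxP symX; split=> [[]//|Xge0]; split=> //.
by apply/symmetricmxP; rewrite linearB /= trmx_mul trmxK symX.
Qed.

Lemma setFR_bound (R : realType) (n : nat) (x : 'cV[R]_n) (X : 'M[R]_n) :
  setFR (x, X) -> forall i j, 0 <= X i j <= 1.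
Proof.
case=> /= bx /symmetricmxP symX XFR.
have H (i j : 'I_n) : (i <= j)%N -> 0 <= X i j <= 1.
  move=> /XFR; rewrite ge_max le_min => /andP[/andP[_ ->] /andP[Xi _]] /=.
  by apply: le_trans Xi _; have /andP[] := bx i.
move=> i j; case: (leqP i j) => [/H//|/ltnW/H].
by rewrite -{3 4}symX mxE.
Qed.

Lemma entry_vec_mx_continuous (R : realType) (m n : nat) (i : 'I_m)
  (j : 'I_n) : continuous (fun v : 'rV[R]_(m * n) => vec_mx v i j).
Proof.
rewrite (_ : (fun v => _) = (fun v : 'rV[R]_(m * n) => v ord0 (mxvec_index i j))).
  exact: coord_continuous.
by apply/funext => v; rewrite mxE.
Qed.

Lemma sum2_continuous (R : realType) (T : topologicalType) (n : nat)
    (a : 'I_n -> 'I_n -> R) (f : 'I_n -> 'I_n -> T -> R) :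
  (forall i j, continuous (f i j)) ->
  continuous (fun v => \sum_i \sum_j a i j * f i j v).
Proof.
move=> cf; apply: continuous_big => [|i _]; first exact: add_continuous.
apply: continuous_big => [|j _]; first exact: add_continuous.
by move=> v; apply: cvgM; [exact: cvg_cst|exact: cf].
Qed.

Lemma closed_fun_le (R : realType) (T : topologicalType) (f g : T -> R) :
  continuous f -> continuous g -> closed [set v | f v <= g v].
Proof.
move=> cf cg; rewrite (_ : mkset _ = (g \- f) @^-1` [set y | 0 <= y]).
  apply: preimage_closed; last exact: closed_ge.
  by move=> v _; apply: continuousB; [exact: cg|exact: cf].
by apply/seteqP; split=> v /=; rewrite subr_ge0.
Qed.

Lemma setFR_closed (R : realType) (n : nat) (x : 'cV[R]_n) :
  closed [set v : 'rV[R]_(n * n) | setFR (x, vec_mx v)].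
Proof.
pose C (i j : 'I_n) := [set v : 'rV[R]_(n * n) | vec_mx v i j <= vec_mx v j i].
pose D (i j : 'I_n) := [set v : 'rV[R]_(n * n) |
  Num.max (x i ord0 + x j ord0 - 1) 0 <= vec_mx v i j] `&`
  [set v | vec_mx v i j <= Num.min (x i ord0) (x j ord0)].
rewrite (_ : mkset _ = [set _ | box x] `&`
  (\bigcap_(p in setT) C p.1 p.2 `&`
   \bigcap_(p in [set p : 'I_n * 'I_n | (p.1 <= p.2)%N]) D p.1 p.2)).
  apply: closedI.
    case: (pselect (box x)) => bx.
      by rewrite (_ : mkset _ = setT); [exact: closedT|apply/seteqP; split].
    by rewrite (_ : mkset _ = set0); [exact: closed0|apply/seteqP; split].
  apply: closedI; apply: closed_bigI => -[i j] _ /=.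
    by apply: closed_fun_le; exact: entry_vec_mx_continuous.
  apply: closedI; apply: closed_fun_le;
    try exact: entry_vec_mx_continuous; exact: cst_continuous.
apply/seteqP; split=> v /=.
  case=> /= bx /symmetricmxP /matrixP symX XFR; split=> //; split.
    by move=> [i j] _ /=; rewrite /C /= -symX mxE.
  by move=> [i j] /= ij; split; have /andP[] := XFR _ _ ij.
case=> bx [symX XFR]; split=> //=.
  apply/symmetricmxP/matrixP => i j; apply/eqP; rewrite [_^T _ _]mxE eq_le.
  by rewrite (symX (i, j)) // (symX (j, i)).
by move=> i j ij; have [/= -> ->] := XFR (i, j) ij.
Qed.

Lemma setFRS_closed (R : realType) (n : nat) (x : 'cV[R]_n) :
  closed [set v : 'rV[R]_(n * n) | setFRS (x, vec_mx v)].
Proof.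
rewrite (_ : mkset _ = [set v : 'rV[R]_(n * n) | setFR (x, vec_mx v)] `&`
  \bigcap_(u in setT) [set v : 'rV[R]_(n * n) |
    0 <= cvinner u ((vec_mx v - x *m x^T) *m u)]).
  apply: closedI; first exact: setFR_closed.
  apply: closed_bigI => u _; apply: closed_fun_le.
    exact: cst_continuous.
  rewrite (_ : (fun v => _) = fun v : 'rV[R]_(n * n) => \sum_i \sum_j
      (u i ord0 * u j ord0) * (vec_mx v i j - (x *m x^T) i j)).
    apply: sum2_continuous => i j v; apply: continuousB.
      exact: entry_vec_mx_continuous.
    exact: cst_continuous.
  apply/funext => v; rewrite cvinner_mulmxE; apply: eq_bigr => i _.
  by apply: eq_bigr => j _; rewrite mulrAC; congr (_ * _); rewrite !mxE.
apply/seteqP; split=> v /=.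
  by case=> FRv [_ psdv]; split=> // u _; exact: psdv.
case=> FRv psdv; split=> //=; apply/psd_rank1_subE; first by case: FRv.
by move=> u; exact: psdv.
Qed.

Lemma lifted_min (R : realType) (n : nat) (K : set ('cV[R]_n * 'M[R]_n))
    (Q : 'M[R]_n) (c x : 'cV[R]_n) :
  K `<=` @setFR R n -> K (x, x *m x^T) ->
  closed [set v : 'rV[R]_(n * n) | K (x, vec_mx v)] ->
  lifted_values K Q c x (inf (lifted_values K Q c x)) /\
  lbound (lifted_values K Q c x) (inf (lifted_values K Q c x)).
Proof.
move=> KFR K0 Kcl; set A := mkset _ in Kcl; set S := lifted_values _ _ _ _.
have Aco : compact A.
  apply: (subclosed_compact Kcl
    (rV_compact (fun _ : 'I_(n * n) => @segment_compact R 0 1))).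
  move=> v /KFR /setFR_bound Xb k /=.
  by case/mxvec_indexP: k => i j; have := Xb i j; rewrite mxE in_itv.
have A0 : A !=set0 by exists (mxvec (x *m x^T)); rewrite /A /= mxvecK.
have fc : continuous (fun v : 'rV[R]_(n * n) => lifted_obj Q c x (vec_mx v)).
  rewrite /lifted_obj => v.
  apply: (@continuousD R R^o _ (fun v => 2^-1 * mxinner Q (vec_mx v))
    (fun=> cvinner c x)); last exact: cst_continuous.
  apply: (@continuousM R _ (fun=> 2^-1) (fun v => mxinner Q (vec_mx v))).
    exact: cst_continuous.
  rewrite (_ : (fun v => _) = fun v : 'rV[R]_(n * n) =>
      \sum_i \sum_j Q i j * vec_mx v i j).
    by apply: sum2_continuous => i j; exact: entry_vec_mx_continuous.
  by apply/funext => w; rewrite mxinnerE.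
have [v /set_mem Av vmin] := compact_EVT_min A0 Aco (continuous_subspaceT fc).
have Sv : S (lifted_obj Q c x (vec_mx v)) by exists (vec_mx v).
have lbv : lbound S (lifted_obj Q c x (vec_mx v)).
  move=> _ [X KX <-]; rewrite -(mxvecK X); apply: vmin.
  by apply/mem_set; rewrite /A /= mxvecK.
suff -> : inf S = lifted_obj Q c x (vec_mx v) by [].
apply/eqP; rewrite eq_le; apply/andP; split.
  by apply: ge_inf => //; exists (lifted_obj Q c x (vec_mx v)).
by apply: lb_le_inf => //; exists (lifted_obj Q c x (vec_mx v)).
Qed.

Lemma ellR_min (R : realType) (n : nat) (Q : 'M[R]_n) (c x : 'cV[R]_n) :
  box x -> lifted_values (@setFR R n) Q c x (ellR Q c x) /\
           lbound (lifted_values (@setFR R n) Q c x) (ellR Q c x).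
Proof.
move=> bx; apply: lifted_min => //; last exact: setFR_closed.
by have [] := setFRS_rank1 bx.
Qed.

Lemma ellRS_min (R : realType) (n : nat) (Q : 'M[R]_n) (c x : 'cV[R]_n) :
  box x -> lifted_values (@setFRS R n) Q c x (ellRS Q c x) /\
           lbound (lifted_values (@setFRS R n) Q c x) (ellRS Q c x).
Proof.
move=> bx; apply: lifted_min; [by move=> p []|exact: setFRS_rank1|].
exact: setFRS_closed.
Qed.

(* Main.v *)
Require Import Defs.
From mathcomp Require Import all_boot all_order all_algebra.
From mathcomp Require Import all_classical all_reals all_analysis.
From mathcomp Require Import ring lra.

Import Order.TTheory GRing.Theory Num.Theory.
Import numFieldNormedType.Exports.
Local Open Scope classical_set_scope.
Local Open Scope ring_scope.

(** Write a feasible matrix as X = x x^T + Y.  The lifted objective is then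
    quad Q c x + <Q, Y> / 2, so a relaxation is exact at x precisely when
    <Q, Y> >= 0 for all feasible perturbations Y of the rank one lift.

    If x_i is 0 or 1, the two McCormick bounds on X_ij coincide with x_i x_j, so
    Y lives on the rows and columns of B = fracset x ([setFR_support]).  If x_i
    and x_j are both fractional, then x_i x_j lies strictly between the bounds,
    so every symmetric Y supported on B x B becomes feasible after scaling by a
    small positive number ([setFR_perturb]).  As the sign of <Q, Y> ignores
    positive scaling, exactness says that Q_BB has nonnegative inner product
    with every symmetric matrix of order #|B| for the first relaxation, with
    every psd matrix of that order for the second ([exact_iff_dual]).

    It remains to compute two dual cones: that of the whole space of symmetric
    matrices is 0 ([symmetric_dual]) and that of the psd cone is itself
    ([psd_dual]).  At a vertex B is empty and both conditions on Q_BB hold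
    trivially, so the vertex alternative is a special case of the other. *)

(** * The trace inner product and congruence *)

Lemma mxinner_congr {R : realType} {m n : nat} (A : 'M[R]_m) (M : 'M[R]_(m, n))
    (Z : 'M[R]_n) :
  mxinner A (M *m Z *m M^T) = mxinner (M^T *m A *m M) Z.
Proof.
by rewrite /mxinner !trmx_mul trmxK !mulmxA mxtrace_mulC !mulmxA.
Qed.

Lemma mxinner_rank1 {R : realType} {n : nat} (A : 'M[R]_n) (v : 'cV[R]_n) :
  mxinner A (v *m v^T) = cvinner v (A *m v).
Proof.
rewrite /mxinner mulmxA mxtrace_mulC mulmxA trace_mx11 /cvinner mulmxA.
have -> : v^T *m A *m v = (v^T *m A^T *m v)^T.
  by rewrite !trmx_mul !trmxK mulmxA.
by rewrite [RHS]mxE.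
Qed.

Lemma mxinnerDr {R : realType} {n : nat} (A Y Z : 'M[R]_n) :
  mxinner A (Y + Z) = mxinner A Y + mxinner A Z.
Proof. by rewrite /mxinner mulmxDr mxtraceD. Qed.

Lemma mxinnerZr {R : realType} {n : nat} (A Y : 'M[R]_n) (a : R) :
  mxinner A (a *: Y) = a * mxinner A Y.
Proof. by rewrite /mxinner -scalemxAr mxtraceZ. Qed.

Lemma symmetric_congr {R : realType} {m n : nat} (M : 'M[R]_(m, n))
    (A : 'M[R]_n) :
  A \is symmetricmx -> M *m A *m M^T \is symmetricmx.
Proof.
move=> /symmetricmxP sA; apply/symmetricmxP.
by rewrite !trmx_mul trmxK sA mulmxA.
Qed.

Lemma psd_congr {R : realType} {m n : nat} (M : 'M[R]_(m, n)) (A : 'M[R]_n) :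
  psd A -> psd (M *m A *m M^T).
Proof.
case=> sA A0; split; first exact: symmetric_congr.
by move=> u; have := A0 (M^T *m u); rewrite /cvinner trmx_mul trmxK !mulmxA.
Qed.

Lemma psd_rank1 {R : realType} {n : nat} (v : 'cV[R]_n) : psd (v *m v^T).
Proof.
split; first by apply/symmetricmxP; rewrite trmx_mul trmxK.
move=> u; rewrite /cvinner -mulmxA mulmxA mxE big_ord1.
by rewrite -[v^T *m u]trmxK trmx_mul trmxK [_^T _ _]mxE -expr2 sqr_ge0.
Qed.

Lemma psdZ {R : realType} {n : nat} (a : R) (A : 'M[R]_n) :
  0 <= a -> psd A -> psd (a *: A).
Proof.
move=> a0 [/symmetricmxP sA A0]; split.
  by apply/symmetricmxP; rewrite linearZ /= sA.
move=> u; rewrite /cvinner -scalemxAl -scalemxAr mxE.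
by apply: mulr_ge0 => //; exact: A0.
Qed.

(** * Self-duality of the positive semidefinite cone *)

Lemma delta_formE {R : realType} {n : nat} (Y : 'M[R]_n) (i j : 'I_n) :
  ((delta_mx i ord0 : 'cV_n)^T *m (Y *m (delta_mx j ord0 : 'cV_n))) ord0 ord0
  = Y i j.
Proof. by rewrite -colE trmx_delta -rowE !mxE. Qed.

Lemma psd_diag_ge0 {R : realType} {n : nat} (Y : 'M[R]_n) (i : 'I_n) :
  psd Y -> 0 <= Y i i.
Proof. by case=> _ /(_ (delta_mx i ord0)); rewrite /cvinner delta_formE. Qed.

Lemma quadratic_form_subZ {R : realType} {n : nat} (Y : 'M[R]_n)
    (u v : 'cV[R]_n) (t : R) :
  cvinner (u - t *: v) (Y *m (u - t *: v)) =
  cvinner u (Y *m u) - t * cvinner u (Y *m v) - t * cvinner v (Y *m u)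
  + t ^+ 2 * cvinner v (Y *m v).
Proof.
rewrite /cvinner mulmxBr [(u - _)^T]linearB /= mulmxBl !mulmxBr.
rewrite [(t *: v)^T]linearZ /=.
rewrite -!scalemxAr -!scalemxAl.
move: (u^T *m _) (u^T *m _) (v^T *m _) (v^T *m _) => a b c d.
by rewrite !mxE; ring.
Qed.

(** If the diagonal vanishes, the quadratic form at e_i - Y_ij e_j equals
    - 2 Y_ij ^ 2. *)
Lemma psd_diag0 {R : realType} {n : nat} (Y : 'M[R]_n) :
  psd Y -> (forall i, Y i i = 0) -> Y = 0.
Proof.
move=> [/symmetricmxP sY Y0] d0; apply/matrixP => i j; rewrite [RHS]mxE.
have Yji : Y j i = Y i j by rewrite -[in LHS]sY mxE.
have := Y0 (delta_mx i ord0 - Y i j *: delta_mx j ord0).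
rewrite quadratic_form_subZ /cvinner !delta_formE !d0 Yji => Y2.
by apply/eqP; rewrite -sqrf_eq0 eq_le sqr_ge0 andbT expr2; lra.
Qed.

(** Clearing row and column i by symmetric Gaussian elimination is a congruence
    of Y, hence keeps semidefiniteness. *)
Lemma psd_deflate {R : realType} {n : nat} (Y : 'M[R]_n) (i : 'I_n) :
  psd Y -> Y i i != 0 -> psd (Y - (Y i i)^-1 *: (col i Y *m (col i Y)^T)).
Proof.
move=> pY Yii0; have [/symmetricmxP sY _] := pY.
pose e : 'cV[R]_n := delta_mx i ord0.
pose a := Y i i.
pose w := col i Y.
pose M := 1%:M - a^-1 *: (w *m e^T).
have wE : Y *m e = w by rewrite /w colE.
have wTE : e^T *m Y = w^T by rewrite -wE trmx_mul sY.
suff -> : Y - a^-1 *: (w *m w^T) = M *m Y *m M^T by exact: psd_congr.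
have MY : M *m Y = Y - a^-1 *: (w *m w^T).
  by rewrite mulmxBl mul1mx -scalemxAl -mulmxA wTE.
have MYe : M *m Y *m e = 0.
  have wTe : w^T *m e = a%:M.
    by apply/matrixP => p q; rewrite !ord1 -wTE -mulmxA delta_formE mxE.
  rewrite MY mulmxBl wE -scalemxAl -mulmxA wTe mul_mx_scalar scalerA.
  by rewrite mulVf // scale1r subrr.
have -> : M^T = 1%:M - a^-1 *: (e *m w^T).
  by rewrite linearB /= linearZ /= trmx1 trmx_mul trmxK.
by rewrite mulmxBr mulmx1 -scalemxAr mulmxA MYe mul0mx scaler0 subr0.
Qed.

(** Deflation at an index with Y i i > 0 writes Y as a psd matrix with one more
    zero on the diagonal plus a positive multiple of v v^T, and the latter
    pairs with A to a value of the quadratic form of A.  Iterating exhausts the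
    diagonal, and a psd matrix with zero diagonal vanishes. *)
Lemma psd_mxinner_ge0 {R : realType} {n : nat} (A Y : 'M[R]_n) :
  psd A -> psd Y -> 0 <= mxinner A Y.
Proof.
move=> pA; have [k] := ubnP #|[pred j | Y j j != 0]|.
elim: k => // k IH in Y *; rewrite ltnS => Yk pY.
have [i /= Yii|d0] := pickP [pred j | Y j j != 0]; last first.
  have -> : Y = 0.
    by apply: psd_diag0 => // i; have /negbFE/eqP := d0 i.
  by rewrite /mxinner mulmx0 mxtrace0.
have pY' := psd_deflate _ _ pY Yii.
set v := col i Y in pY'; set Y' := Y - _ in pY'.
have Yi0 : 0 <= (Y i i)^-1 by rewrite invr_ge0; exact: psd_diag_ge0.
have Y'E j : Y' j j = Y j j - (Y i i)^-1 * (Y j i * Y j i).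
  by rewrite /Y' !mxE big_ord1 !mxE.
have -> : Y = Y' + (Y i i)^-1 *: (v *m v^T) by rewrite subrK.
rewrite mxinnerDr mxinnerZr mxinner_rank1 addr_ge0 //; last first.
  by apply: mulr_ge0 => //; case: pA => _; exact.
apply: IH => //; apply: leq_trans Yk.
apply/proper_card/properP; split; last first.
  by exists i; rewrite !inE // Y'E mulrA mulVf // mul1r subrr eqxx.
(* An old zero Y j j survives: Y' j j is minus a square, and nonnegative. *)
apply/fintype.subsetP => j; rewrite !inE; apply: contraNneq => Yjj.
have := psd_diag_ge0 _ j pY'; rewrite Y'E Yjj sub0r oppr_ge0 => le0.
have ge0 : 0 <= (Y i i)^-1 * (Y j i * Y j i).
  by apply: mulr_ge0 => //; rewrite -expr2 sqr_ge0.
by rewrite oppr_eq0 eq_le le0 ge0.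
Qed.

(** Testing against the rank one matrices u u^T recovers the quadratic form;
    the other direction is Fejer's inequality above. *)
Lemma psd_dual {R : realType} {n : nat} (A : 'M[R]_n) :
  A \is symmetricmx ->
  psd A <-> forall Z, psd Z -> 0 <= mxinner A Z.
Proof.
move=> sA; split=> [pA Z|A0]; first exact: psd_mxinner_ge0.
by split=> // u; rewrite -mxinner_rank1; apply: A0; exact: psd_rank1.
Qed.

(** The test matrix Z = - A gives minus the sum of the squared entries of A. *)
Lemma symmetric_dual {R : realType} {n : nat} (A : 'M[R]_n) :
  A \is symmetricmx ->
  A = 0 <-> forall Z, Z \is symmetricmx -> 0 <= mxinner A Z.
Proof.
move=> sA; split=> [-> Z _|/(_ (- A))].
  by rewrite /mxinner linear0 mul0mx mxtrace0.
have sNA : - A \is symmetricmx.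
  by apply/symmetricmxP; rewrite linearN /= (symmetricmxP _ sA).
move=> /(_ sNA); rewrite mxinnerE => le0.
have ge0 i j : 0 <= A i j * A i j by rewrite -expr2 sqr_ge0.
have S0 : \sum_i \sum_j A i j * A i j = 0.
  apply/eqP; rewrite eq_le; apply/andP; split; last first.
    by apply: sumr_ge0 => i _; apply: sumr_ge0.
  rewrite -oppr_ge0 -sumrN; apply: le_trans le0 _; apply: ler_sum => i _.
  by rewrite -sumrN; apply: ler_sum => j _; rewrite mxE mulrN.
apply/matrixP => i j; rewrite [RHS]mxE; apply/eqP.
have Si0 :=
  psumr_eq0P (fun i _ => sumr_ge0 _ (fun j _ => ge0 i j)) S0.
have /eqP : A i j * A i j = 0 :=
  psumr_eq0P (fun j _ => ge0 i j) (Si0 i isT) isT.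
by rewrite mulf_eq0 orbb.
Qed.

(** * Principal submatrices and extension by zero *)

(** Multiplying by this matrix on the left and by its transpose on the right
    extracts the rows and columns of B; exchanging the two factors extends by
    zero.
    Extraction and extension thus become congruences, which preserve symmetry
    and semidefiniteness. *)
Definition select_mx {R : realType} {n : nat} (B : {set 'I_n}) :
    'M[R]_(#|B|, n) :=
  rowsub enum_val 1%:M.

Definition extend_mx {R : realType} {n : nat} {B : {set 'I_n}}
    (Z : 'M[R]_#|B|) : 'M[R]_n :=
  (select_mx B)^T *m Z *m select_mx B.

Lemma principal_submxE {R : realType} {n : nat} (Q : 'M[R]_n)
    (B : {set 'I_n}) :
  principal_submx Q B = select_mx B *m Q *m (select_mx B)^T.
Proof.
rewrite /select_mx mul_rowsub_mx mul1mx trmx_mxsub trmx1 mulmx_colsub mulmx1.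
by apply/matrixP => i j; rewrite !mxE.
Qed.

Lemma extend_mxE {R : realType} {n : nat} (B : {set 'I_n})
    (Z : 'M[R]_#|B|) :
  extend_mx Z = (select_mx B)^T *m Z *m ((select_mx B)^T)^T.
Proof. by rewrite trmxK. Qed.

(** Extension by zero is the adjoint of taking the principal submatrix. *)
Lemma mxinner_extend {R : realType} {n : nat} (Q : 'M[R]_n) (B : {set 'I_n})
    (Z : 'M[R]_#|B|) :
  mxinner Q (extend_mx Z) = mxinner (principal_submx Q B) Z.
Proof.
by rewrite extend_mxE mxinner_congr trmxK principal_submxE.
Qed.

Lemma select_mxE {R : realType} {n : nat} (B : {set 'I_n}) (k : 'I_#|B|)
    (j : 'I_n) :
  select_mx B k j = (enum_val k == j)%:R :> R.
Proof. by rewrite !mxE. Qed.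

Lemma select_proj {R : realType} {n : nat} (B : {set 'I_n}) (i j : 'I_n) :
  ((select_mx B)^T *m select_mx B) i j = ((i == j) && (i \in B))%:R :> R.
Proof.
rewrite mxE; under eq_bigr => k _ do rewrite mxE !select_mxE -natrM mulnb.
have [iB|iB] := boolP (i \in B); last first.
  rewrite andbF big1 // => k _; case: eqP => //= ki.
  by move: iB; rewrite -ki enum_valP.
rewrite (bigD1 (enum_rank_in iB i)) //= enum_rankK_in // eqxx andbT.
rewrite big1 ?addr0 // => k ki; case: eqP => //= ik.
by case/eqP: ki; apply: enum_val_inj; rewrite enum_rankK_in.
Qed.

Lemma extend_mx_out {R : realType} {n : nat} (B : {set 'I_n})
    (Z : 'M[R]_#|B|) (i j : 'I_n) :
  (i \notin B) || (j \notin B) -> extend_mx Z i j = 0.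
Proof.
have sel0 k l : l \notin B -> select_mx B k l = 0 :> R.
  by rewrite select_mxE; case: eqP => // <-; rewrite enum_valP.
rewrite /extend_mx => /orP[iB|jB].
  by rewrite -mulmxA mxE big1 // => k _; rewrite mxE sel0 // mul0r.
by rewrite mxE big1 // => k _; rewrite sel0 // mulr0.
Qed.

Lemma principal_submxK {R : realType} {n : nat} (B : {set 'I_n})
    (Y : 'M[R]_n) :
  (forall i j, (i \notin B) || (j \notin B) -> Y i j = 0) ->
  extend_mx (principal_submx Y B) = Y.
Proof.
move=> Y0; set P := (select_mx B)^T *m select_mx B : 'M[R]_n.
have -> : extend_mx (principal_submx Y B) = P *m Y *m P.
  by rewrite /extend_mx principal_submxE !mulmxA.
have PY : P *m Y = Y.
  apply/matrixP => i j; rewrite mxE (bigD1 i) //= select_proj eqxx /=.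
  rewrite big1 => [|k ki]; last first.
    by rewrite select_proj eq_sym (negbTE ki) mul0r.
  by case: (boolP (i \in B)) => iB; rewrite ?mul1r ?mul0r addr0 // Y0 ?iB.
rewrite PY; apply/matrixP => i j; rewrite mxE (bigD1 j) //= select_proj eqxx /=.
rewrite big1 => [|k kj]; last by rewrite select_proj (negbTE kj) mulr0.
by case: (boolP (j \in B)) => jB; rewrite ?mulr1 ?mulr0 addr0 // Y0 ?jB ?orbT.
Qed.

(** * Feasible perturbations of the rank one lift *)

Lemma rank1E {R : realType} {n : nat} (x : 'cV[R]_n) (i j : 'I_n) :
  (x *m x^T) i j = x i ord0 * x j ord0.
Proof. by rewrite mxE big_ord1 mxE. Qed.

Lemma notin_fracset {R : realType} {n : nat} (x : 'cV[R]_n) (i : 'I_n) :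
  box x -> i \notin fracset x -> x i ord0 = 0 \/ x i ord0 = 1.
Proof.
move=> /(_ i) /andP[x0 x1]; rewrite inE negb_and -!leNgt => /orP[xi|xi].
  by left; apply/eqP; rewrite eq_le xi x0.
by right; apply/eqP; rewrite eq_le xi x1.
Qed.

(** For x_i = 0 the upper bound on X_ij is 0, and for x_i = 1 both bounds equal
    x_j; either way X_ij is forced to be x_i x_j. *)
Lemma setFR_support {R : realType} {n : nat} (x : 'cV[R]_n) (X : 'M[R]_n)
    (i j : 'I_n) :
  setFR (x, X) -> (i \notin fracset x) || (j \notin fracset x) ->
  (X - x *m x^T) i j = 0.
Proof.
case=> /= bx /symmetricmxP sX XFR.
wlog ij : i j / (i <= j)%N.
  move=> H; case: (leqP i j) => [/H//|/ltnW/H{}H].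
  have Xji : X j i = X i j by rewrite -[in LHS]sX mxE.
  by rewrite orbC => /H; rewrite !mxE !big_ord1 !mxE Xji mulrC.
have := XFR i j ij; rewrite ge_max le_min => /andP[/andP[h1 h2] /andP[h3 h4]].
rewrite mxE [X in _ + X]mxE rank1E.
by move=> /orP[]/(notin_fracset _ _ bx)[] e; move: h1 h2 h3 h4; rewrite e;
  rewrite ?(mul0r, mulr0, mul1r, mulr1) => *; lra.
Qed.

(** For fractional x_i and x_j the product x_i x_j satisfies both McCormick
    bounds strictly: x_i x_j - (x_i + x_j - 1) = (1 - x_i) (1 - x_j) > 0 and
    x_i x_j < x_i, x_j.  Only finitely many such strict inequalities have to
    survive the perturbation. *)
Lemma setFR_perturb {R : realType} {n : nat} (x : 'cV[R]_n) (Y : 'M[R]_n) :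
  box x -> Y \is symmetricmx ->
  (forall i j, (i \notin fracset x) || (j \notin fracset x) -> Y i j = 0) ->
  exists2 t : R, 0 < t & setFR (x, x *m x^T + t *: Y).
Proof.
move=> bx /symmetricmxP sY Y0.
have [_ /symmetricmxP /= sxx xxFR] := (setFRS_rank1 bx).1.
pose feasible (p : 'I_n * 'I_n) (t : R) := (p.1 <= p.2)%N ->
  Num.max (x p.1 ord0 + x p.2 ord0 - 1) 0 <= (x *m x^T + t *: Y) p.1 p.2
    <= Num.min (x p.1 ord0) (x p.2 ord0).
have feas_near : \forall t \near (0 : R)^'+, forall p, feasible p t; last first.
  near (0 : R)^'+ => t; exists t => //; split => //=.
    by apply/symmetricmxP; rewrite linearD linearZ /= sxx sY.
  have feas_t : forall p, feasible p t by near: t.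
  by move=> i j; exact: (feas_t (i, j)).
have entryE (t : R) i j :
    (x *m x^T + t *: Y) i j = (x *m x^T) i j + t * Y i j by rewrite !mxE.
apply: filter_forall => -[i j]; rewrite /feasible /=.
have [out|] := boolP ((i \notin fracset x) || (j \notin fracset x)).
  near=> t => ij; rewrite entryE Y0 // mulr0 addr0.
  exact: xxFR.
rewrite negb_or !negbK !inE => /andP[/andP[xi0 xi1] /andP[xj0 xj1]].
have cv : (fun t : R => x i ord0 * x j ord0 + t * Y i j) @ 0^'+ -->
    x i ord0 * x j ord0 + 0 * Y i j.
  apply: cvg_at_right_filter; apply: cvgD; first exact: cvg_cst.
  by apply: cvgM; [exact: cvg_id|exact: cvg_cst].
rewrite mul0r addr0 in cv.
near=> t => _.
rewrite entryE rank1E; apply/andP; split; apply: ltW.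
  near: t; apply: (cvgr_gt _ cv); rewrite gt_max mulr_gt0 // andbT; nra.
near: t; apply: (cvgr_lt _ cv); rewrite lt_min; apply/andP; split; nra.
Unshelve. all: by end_near.
Qed.

(** * Exactness of a relaxation over a cone of perturbations *)

Lemma lifted_obj_rank1D {R : realType} {n : nat} (Q : 'M[R]_n)
    (c x : 'cV[R]_n) (Y : 'M[R]_n) :
  lifted_obj Q c x (x *m x^T + Y) = quad Q c x + 2^-1 * mxinner Q Y.
Proof. by rewrite /lifted_obj /quad mxinnerDr mxinner_rank1; ring. Qed.

(** Here C stands for the cone of directions on B x B that can be followed from
    the rank one lift within K.  The value at the rank one lift is quad Q c x,
    so l never exceeds it, and equality means that no direction in C decreases
    the objective. *)
Lemma exact_iff_dual {R : realType} {n : nat}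
    (K : set ('cV[R]_n * 'M[R]_n)) (Q : 'M[R]_n) (c x : 'cV[R]_n)
    (C : 'M[R]_#|fracset x| -> Prop) (l : R) :
  lifted_values K Q c x l -> lbound (lifted_values K Q c x) l ->
  K `<=` @setFR R n -> K (x, x *m x^T) ->
  (forall X, K (x, X) -> C (principal_submx (X - x *m x^T) (fracset x))) ->
  (forall Z, C Z -> exists2 t, 0 < t & K (x, x *m x^T + t *: extend_mx Z)) ->
  l = quad Q c x <->
  forall Z, C Z -> 0 <= mxinner (principal_submx Q (fracset x)) Z.
Proof.
move=> [X KX lE] lb KFR K0 KC CK; split=> [lq Z /CK[t t0 KZ]|Cge0].
  have := lb _ (ex_intro2 _ _ _ KZ erefl).
  rewrite lifted_obj_rank1D lq mxinnerZr mxinner_extend lerDl.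
  by rewrite pmulr_rge0 ?invr_gt0 // pmulr_rge0.
apply/eqP; rewrite eq_le; apply/andP; split.
  apply: lb; exists (x *m x^T) => //.
  rewrite -[x *m x^T]addr0 lifted_obj_rank1D /mxinner mulmx0 mxtrace0.
  by rewrite mulr0 addr0.
rewrite -lE -[X](subrKC (x *m x^T)) lifted_obj_rank1D lerDl.
rewrite pmulr_rge0 ?invr_gt0 //.
rewrite -(principal_submxK (fracset x) (X - x *m x^T)) => [|i j].
  by rewrite mxinner_extend; apply/Cge0/KC.
by apply: setFR_support; exact: KFR.
Qed.

Lemma vertex_submx0 {R : realType} {n : nat} (Q : 'M[R]_n) (x : 'cV[R]_n) :
  vertex (@box R n) x -> principal_submx Q (fracset x) = 0.
Proof.
move=> /vertex_boxP x01; apply/matrixP => i; have := enum_valP i.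
by rewrite inE; case: (x01 (enum_val i)) => ->; rewrite ltxx ?andbF.
Qed.

Theorem lemma3p4 (R : realType) (n : nat) (hn : (1 <= n)%N)
    (Q : 'M[R]_n) (hQ : Q \is symmetricmx) (c x : 'cV[R]_n)
    (hx : box x) :
  (ellR Q c x = quad Q c x <->
     vertex (@box R n) x \/ principal_submx Q (fracset x) = 0) /\
  (ellRS Q c x = quad Q c x <->
     vertex (@box R n) x \/ psd (principal_submx Q (fracset x))).
Proof.
set B := fracset x; set QB := principal_submx Q B.
have FRS0 := setFRS_rank1 hx; have FR0 := FRS0.1.
have sub_sym (A : 'M[R]_n) : A \is symmetricmx ->
    principal_submx A B \is symmetricmx.
  by move=> sA; rewrite principal_submxE; exact: symmetric_congr.
have sQB : QB \is symmetricmx by exact: sub_sym.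
have ext_sym (Z : 'M[R]_#|B|) : Z \is symmetricmx ->
    extend_mx Z \is symmetricmx.
  by move=> sZ; rewrite extend_mxE; exact: symmetric_congr.
have perturb (Z : 'M[R]_#|B|) : Z \is symmetricmx ->
    exists2 t : R, 0 < t & setFR (x, x *m x^T + t *: extend_mx Z).
  move=> sZ; apply: setFR_perturb => //; first exact: ext_sym.
  by move=> i j; exact: extend_mx_out.
have [vR lbR] := ellR_min Q c hx.
have [vRS lbRS] := ellRS_min Q c hx.
split.
- apply: iff_trans
    (_ : (forall Z, Z \is symmetricmx -> 0 <= mxinner QB Z) <-> _).
    apply: (exact_iff_dual _ _ _ _ _ _ vR lbR) => // X [_ /= sX _].
    apply: sub_sym; apply/symmetricmxP.
    by rewrite linearB /= trmx_mul trmxK (symmetricmxP _ sX).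
  apply: iff_trans (iff_sym (symmetric_dual _ sQB)) _.
  by split=> [|[/(vertex_submx0 Q)|]//]; first by right.
- apply: iff_trans (_ : (forall Z, psd Z -> 0 <= mxinner QB Z) <-> _).
    apply: (exact_iff_dual _ _ _ _ _ _ vRS lbRS) => //; first by move=> ? [].
      by move=> X [_ /= pX]; rewrite principal_submxE; exact: psd_congr.
    move=> Z pZ; have [t t0 FRt] := perturb Z pZ.1; exists t => //.
    split=> //=; rewrite addrC addKr; apply: psdZ; first exact: ltW.
    by rewrite extend_mxE; exact: psd_congr.
  apply: iff_trans (iff_sym (psd_dual _ sQB)) _.
  split=> [|[/(vertex_submx0 Q) QB0|]//]; first by right.
  rewrite /QB QB0; split; first by apply/symmetricmxP; rewrite linear0.
  by move=> u; rewrite /cvinner mul0mx mulmx0 mxE.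
Qed.
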